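(* Let $\{a_n,b_n\}_{n=1}^\infty$ be Jacobi parameters, $E_0\in\mathbb{R}$, and let $E',E''$ be two distinct zeros of $p_L(x)$. Then $$|E'-E_0|+|E''-E_0|\ \ge\ \|A_L(E_0)\|^{-1}.$$ In particular, $$\bigl|z_L^{(+1)}(E_0)-z_L^{(-1)}(E_0)\bigr|\ \ge\ \|A_L(E_0)\|^{-1}$$ (whenever both zeros $z_L^{(\pm1)}(E_0)$ exist).
   Context: Jacobi parameters are bounded sequences $a_n>0$, $b_n\in\mathbb{R}$ ($n\ge1$), with the convention $a_0=1$. The orthonormal polynomials are defined by $p_{-1}=0$, $p_0=1$, $xp_n=a_{n+1}p_{n+1}+b_{n+1}p_n+a_np_{n-1}$, $n\ge0$. For $\theta\in[0,\pi)$, $u_n(E,\theta)$ is the solution of $a_nu_{n+1}+(b_n-E)u_n+a_{n-1}u_{n-1}=0$, $n=1,2,\dots$, with $u_0(E,\theta)=\sin\theta$, $u_1(E,\theta)=\cos\theta$. Let $$K(n,m;E)=u_n(E,0)u_m(E,\pi/2)-u_n(E,\pi/2)u_m(E,0).$$ $A_L(E)$ is the operator on $\mathbb{C}^L=\{(v_k)_{k=1}^L\}$ given by $(A_L(E)v)_n=\sum_{m=1}^nK(n,m;E)v_m$, and $\|A_L(E)\|$ is its operator norm for the Euclidean norm on $\mathbb{C}^L$. $z_L^{(-1)}(E_0)$ is the largest zero of $p_L$ that is $\le E_0$; $z_L^{(+1)}(E_0)$ is the smallest zero of $p_L$ that is $>E_0$. *)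

(* Defs.v *)
From HB Require Import structures.
From mathcomp Require Import all_boot all_order all_algebra.
From mathcomp Require Import all_classical all_reals all_analysis.
From mathcomp Require Import complex.

Set Implicit Arguments.
Unset Strict Implicit.
Unset Printing Implicit Defensive.

Import Order.TTheory GRing.Theory Num.Theory.
Import numFieldNormedType.Exports.

Local Open Scope classical_set_scope.
Local Open Scope ring_scope.

(* The sequences are indexed by nat so that indices agree with the usual
   ones (n >= 1); a 0 carries the convention a_0 = 1 and b 0 is never used. *)
Definition jacobi_parameters (R : realType) (a b : nat -> R) : Prop :=
  [/\ a 0%N = 1, (forall n, (1 <= n)%N -> 0 < a n),
      bounded_fun a & bounded_fun b].

(* The inner match is p_{n-1}, with p_{-1} = 0. *)
Fixpoint jacobi_poly (R : realType) (a b : nat -> R) (n : nat) : {poly R} :=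
  if n is n'.+1 then
    (a n)^-1 *: (('X - (b n)%:P) * jacobi_poly a b n'
                 - a n' *: (if n' is m.+1 then jacobi_poly a b m else 0))
  else 1.

(* n-th term of the solution of
   a_n u_{n+1} + (b_n - E) u_n + a_{n-1} u_{n-1} = 0 (n >= 1)
   with u_0 = sin theta and u_1 = cos theta. *)
Fixpoint jacobi_sol (R : realType) (a b : nat -> R) (E theta : R) (n : nat)
    : R :=
  match n with
  | 0 => sin theta
  | n'.+1 =>
      match n' with
      | 0 => cos theta
      | m.+1 => (a n')^-1 * ((E - b n') * jacobi_sol a b E theta n'
                             - a m * jacobi_sol a b E theta m)
      end
  end.

Definition jacobi_kernel (R : realType) (a b : nat -> R) (n m : nat) (E : R)
    : R :=
  jacobi_sol a b E 0 n * jacobi_sol a b E (pi / 2) m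
  - jacobi_sol a b E (pi / 2) n * jacobi_sol a b E 0 m.

(* C^L is 'cV[R[i]]_L; the ordinal k stands for the coordinate k + 1. *)
Definition jacobi_op (R : realType) (a b : nat -> R) (L : nat) (E : R)
    (v : 'cV[R[i]]_L) : 'cV[R[i]]_L :=
  \col_n \sum_(m < L | (m <= n)%N)
    real_complex R (jacobi_kernel a b n.+1 m.+1 E) * v m 0.

Definition l2norm (R : realType) (L : nat) (v : 'cV[R[i]]_L) : R :=
  Num.sqrt (\sum_(k < L) ComplexField.Normc.normc (v k 0) ^+ 2).

Definition opnorm (R : realType) (L : nat)
    (T : 'cV[R[i]]_L -> 'cV[R[i]]_L) : R :=
  sup [set l2norm (T v) | v in [set v | l2norm v <= 1]].

Definition is_zero_below (R : realType) (q : {poly R}) (E0 z : R) : Prop :=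
  [/\ root q z, z <= E0 & forall w, root q w -> w <= E0 -> w <= z].

Definition is_zero_above (R : realType) (q : {poly R}) (E0 z : R) : Prop :=
  [/\ root q z, E0 < z & forall w, root q w -> E0 < w -> z <= w].

Lemma jacobi_poly_rec (R : realType) (a b : nat -> R) (n : nat) :
  jacobi_parameters a b ->
  'X * jacobi_poly a b n = a n.+1 *: jacobi_poly a b n.+1
    + b n.+1 *: jacobi_poly a b n
    + a n *: (if n is m.+1 then jacobi_poly a b m else 0).
Proof.
case=> _ a_gt0 _ _; rewrite [jacobi_poly a b n.+1]/=.
rewrite scalerA divff ?gt_eqF ?a_gt0// scale1r mulrBl mul_polyC.
by rewrite addrAC subrK subrK.
Qed.

Lemma jacobi_sol_rec (R : realType) (a b : nat -> R) (E theta : R) (n : nat) :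
  jacobi_parameters a b ->
  a n.+1 * jacobi_sol a b E theta n.+2
    + (b n.+1 - E) * jacobi_sol a b E theta n.+1
    + a n * jacobi_sol a b E theta n = 0.
Proof.
case=> _ a_gt0 _ _; rewrite [jacobi_sol a b E theta n.+2]/=.
rewrite mulrA divff ?gt_eqF ?a_gt0// mul1r -[b n.+1 - E]opprB mulNr.
by rewrite addrAC subrK subrr.
Qed.

(* Main.v *)
Require Import Defs.
From mathcomp Require Import all_boot all_order all_algebra.
From mathcomp Require Import all_classical all_reals all_analysis.
From mathcomp Require Import complex.
From mathcomp Require Import ring lra.

(** Write f_E for the vector (p_0(E), ..., p_(L-1)(E)); its entries are the
    values at E of the solution with theta = 0, taken at the indices 1, ..., L.

    Green's identity [jacobi_green] for two solutions of the recursion, at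
    possibly different energies, gives two facts.  First, if E' and E'' are
    distinct zeros of p_L, the boundary terms vanish and f_E', f_E'' are
    orthogonal ([jacobi_orthogonal]; they are eigenvectors of the truncated
    Jacobi matrix).  Second, variation of parameters ([jacobi_variation]):
        f_E = f_E0 + (E - E0) A f_E,   where A = A_L(E0).

    Subtracting the second fact for E'' from that for E' eliminates f_E0:
        f_E' - f_E'' = (E' - E0) A f_E' - (E'' - E0) A f_E''.
    By orthogonality, the square D of the norm of the left-hand side is
    |f_E'|^2 + |f_E''|^2, so neither |f_E'| nor |f_E''| exceeds sqrt D.  The
    right-hand side therefore has norm at most
    (|E' - E0| + |E'' - E0|) ||A|| sqrt D, and dividing by sqrt D, which is
    positive because p_0 = 1, gives the bound.  The estimate is carried out on
    squares: pointwise convexity of the square ([sqr_comb_le]) then replaces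
    the triangle inequality for the Euclidean norm.

    The operator norm is a supremum, hence an upper bound only once A is known
    to be bounded; [l2norm_opnorm] and [jacobi_op_bounded] take care of this,
    and [jacobi_op_real_sqnorm] specializes the bound to real vectors.  For the
    consecutive zeros around E0, the sum of the distances to E0 is the
    distance between the zeros. *)

Set Implicit Arguments.
Unset Strict Implicit.
Unset Printing Implicit Defensive.

Import Order.TTheory GRing.Theory Num.Theory.
Local Open Scope ring_scope.

(** The sequence n |-> jacobi_sol a b E 0 n.+1 is p_n(E), because both satisfy
    the same recursion with the same initial data. *)
Lemma horner_jacobi_poly (R : realType) (a b : nat -> R) (E : R) (n : nat) :
  (jacobi_poly a b n).[E] = jacobi_sol a b E 0 n.+1.
Proof.
suff: (jacobi_poly a b n).[E] = jacobi_sol a b E 0 n.+1 /\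
      (jacobi_poly a b n.+1).[E] = jacobi_sol a b E 0 n.+2 by case.
elim: n => [|n [IHn IHn1]].
  split; first by rewrite /= hornerE cos0.
  by rewrite /= sin0 cos0 scaler0 !(hornerE, mulr0, mulr1, subr0).
split=> //; rewrite [jacobi_sol _ _ _ _ n.+3]/= -/(jacobi_sol a b E 0 n.+2).
rewrite -/(jacobi_sol a b E 0 n.+1) -IHn -IHn1.
rewrite [jacobi_poly a b n.+2]/= -/(jacobi_poly a b n.+1).
by rewrite !(hornerZ, hornerD, hornerN, hornerM, hornerX, hornerC).
Qed.

(** Summation by parts: the sum telescopes, as the recursion makes (E - E') u v
    the increment of the weighted Wronskian
    a_n (u_(n+1) v_n - u_n v_(n+1)). *)
Lemma jacobi_green (R : realType) (a b : nat -> R) (E E' t t' : R) (n : nat) :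
  jacobi_parameters a b ->
  let u := jacobi_sol a b E t in
  let v := jacobi_sol a b E' t' in
  (E - E') * (\sum_(m < n) u m.+1 * v m.+1) =
  a n * (u n.+1 * v n - u n * v n.+1) - (u 1%N * v 0%N - u 0%N * v 1%N).
Proof.
move=> hab u v; have a0 : a 0%N = 1 by case: hab.
elim: n => [|n IHn]; first by rewrite big_ord0 mulr0 a0 mul1r subrr.
rewrite big_ord_recr mulrDr IHn.
have hu : a n.+1 * u n.+2 = - ((b n.+1 - E) * u n.+1 + a n * u n).
  by apply/eqP; rewrite -addr_eq0 addrA (@jacobi_sol_rec R a b E t n hab).
have hv : a n.+1 * v n.+2 = - ((b n.+1 - E') * v n.+1 + a n * v n).
  by apply/eqP; rewrite -addr_eq0 addrA (@jacobi_sol_rec R a b E' t' n hab).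
clearbody u v; rewrite /= [in RHS]mulrBr [a n.+1 * (u n.+2 * _)]mulrA hu.
rewrite [a n.+1 * (u n.+1 * _)]mulrCA hv.
by ring.
Qed.

(** Expand the kernel and apply Green's identity to f = u(E, 0) against each of
    u = u(E0, 0) and v = u(E0, pi/2).  The terms in f_(n+1) cancel and f_n is
    left multiplied by the Wronskian of u and v, which Green's identity at
    equal energies shows to be 1; the boundary terms at 0 contribute u_n. *)
Lemma jacobi_variation (R : realType) (a b : nat -> R) (E E0 : R) (n : nat) :
  jacobi_parameters a b ->
  jacobi_sol a b E 0 n - jacobi_sol a b E0 0 n =
  (E - E0) * \sum_(m < n) jacobi_kernel a b n m.+1 E0 * jacobi_sol a b E 0 m.+1.
Proof.
move=> hab.
have hu := @jacobi_green R a b E E0 0 0 n hab.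
have hv := @jacobi_green R a b E E0 0 (pi / 2) n hab.
have hw := @jacobi_green R a b E0 E0 0 (pi / 2) n hab.
have s0 e t : jacobi_sol a b e t 0 = sin t by [].
have s1 e t : jacobi_sol a b e t 1 = cos t by [].
cbv zeta in hu, hv, hw.
rewrite !s0 !s1 ?sin_pihalf ?cos_pihalf sin0 cos0 in hu hv hw.
rewrite /jacobi_kernel.
under eq_bigr => m _.
  have -> (x u v u' v' : R) : (u * v' - v * u') * x = u * (x * v') - v * (x * u').
    by ring.
  over.
rewrite sumrB -!mulr_sumr mulrBr !(mulrCA (E - E0)) hu hv.
move: hw; rewrite subrr mul0r.
set u := jacobi_sol a b E0 0; set v := jacobi_sol a b E0 (pi / 2).
set f := jacobi_sol a b E 0; rewrite -/u -/v => hw.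
have {}hw : a n * (u n.+1 * v n - u n * v n.+1) = 1 by lra.
rewrite -[f n in LHS]mulr1 -{1}hw; ring.
Qed.

(** In Green's identity the boundary term at L vanishes because
    u_(L+1) = p_L = 0 at both zeros, and that at 0 because u_0 = 0. *)
Lemma jacobi_orthogonal (R : realType) (a b : nat -> R) (L : nat) (E E' : R) :
  jacobi_parameters a b ->
  root (jacobi_poly a b L) E -> root (jacobi_poly a b L) E' -> E <> E' ->
  \sum_(m < L) jacobi_sol a b E 0 m.+1 * jacobi_sol a b E' 0 m.+1 = 0.
Proof.
move=> hab /rootP; rewrite horner_jacobi_poly => pE.
move=> /rootP; rewrite horner_jacobi_poly => pE' /eqP; rewrite -subr_eq0 => neq.
apply: (mulfI neq); rewrite (@jacobi_green R a b E E' 0 0 L hab) pE pE' mulr0.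
by rewrite /= sin0 !(mulr0, mul0r, subr0).
Qed.

Section Norms.

Variable R : realType.
Local Notation C := R[i].
Local Notation normc := (@ComplexField.Normc.normc R).

(** The type Rcomplex R is R[i] with this real-valued norm as its norm. *)
Lemma normc_ge0 (c : C) : 0 <= normc c.
Proof. exact: (@normr_ge0 R (Rcomplex R)). Qed.

Lemma l2norm_ge0 (L : nat) (v : 'cV[C]_L) : 0 <= l2norm v.
Proof. exact: sqrtr_ge0. Qed.

Lemma l2normZ (L : nat) (c : C) (v : 'cV[C]_L) :
  l2norm (c *: v) = normc c * l2norm v.
Proof.
rewrite /l2norm; under eq_bigr do rewrite mxE ComplexField.Normc.normcM exprMn.
rewrite -mulr_sumr sqrtrM ?sqr_ge0// sqrtr_sqr ger0_norm//.
exact: normc_ge0.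
Qed.

Lemma normc_real (x : R) : normc (real_complex R x) = `|x|.
Proof. by rewrite /= expr0n addr0 sqrtr_sqr. Qed.

Lemma normc_le_l2norm (L : nat) (v : 'cV[C]_L) (k : 'I_L) :
  normc (v k 0) <= l2norm v.
Proof.
rewrite /l2norm (bigD1 k)//= -{1}[normc _](ger0_norm (normc_ge0 _)) -sqrtr_sqr.
by rewrite ler_sqrt ?lerDl ?addr_ge0 ?sumr_ge0 ?sqr_ge0// => i _; exact: sqr_ge0.
Qed.

Lemma normc_sum (I : finType) (P : pred I) (F : I -> C) :
  normc (\sum_(i | P i) F i) <= \sum_(i | P i) normc (F i).
Proof.
exact: (@ler_norm_sum R (Rcomplex R)).
Qed.

(** The a priori bound M makes the supremum that defines opnorm finite, and
    forces T v = 0 when v = 0; otherwise normalize v. *)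
Lemma l2norm_opnorm (L : nat) (T : 'cV[C]_L -> 'cV[C]_L) (M : R) :
  (forall c v, T (c *: v) = c *: T v) ->
  (forall v, l2norm (T v) <= M * l2norm v) ->
  forall v, l2norm (T v) <= opnorm T * l2norm v.
Proof.
move=> TZ Tle v.
have [v0|v_neq0] := eqVneq (l2norm v) 0.
  by rewrite v0 mulr0; have := Tle v; rewrite v0 mulr0.
have v_gt0 : 0 < l2norm v by rewrite lt_neqAle eq_sym v_neq0 l2norm_ge0.
pose c := real_complex R (l2norm v)^-1.
have nc : normc c = (l2norm v)^-1 by rewrite normc_real ger0_norm// invr_ge0 ltW.
rewrite -ler_pdivrMr// mulrC -nc -l2normZ -TZ; apply: ub_le_sup.
  exists (`|M|) => _ [w /= w1 <-]; apply: le_trans (Tle w) _.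
  apply: le_trans (ler_wpM2r (l2norm_ge0 _) (ler_norm M)) _.
  by rewrite ler_piMr.
by exists (c *: v) => //=; rewrite l2normZ nc mulVf.
Qed.

Lemma jacobi_opZ (a b : nat -> R) (L : nat) (E : R) (c : C) (v : 'cV[C]_L) :
  jacobi_op a b E (c *: v) = c *: jacobi_op a b E v.
Proof.
apply/matrixP => i j; rewrite !mxE mulr_sumr; apply: eq_bigr => m _.
by rewrite mxE mulrCA.
Qed.

(** Any bound will do; this one estimates each coordinate of the image by the
    absolute row sum of the kernel. *)
Lemma jacobi_op_bounded (a b : nat -> R) (L : nat) (E : R) :
  exists M, forall v : 'cV[C]_L, l2norm (jacobi_op a b E v) <= M * l2norm v.
Proof.
pose r (n : 'I_L) := \sum_(m < L | (m <= n)%N) `|jacobi_kernel a b n.+1 m.+1 E|.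
have r_ge0 n : 0 <= r n by apply: sumr_ge0.
exists (Num.sqrt (\sum_n r n ^+ 2)) => v.
rewrite -[X in _ * X](ger0_norm (l2norm_ge0 v)) -sqrtr_sqr -sqrtrM; last first.
  by apply: sumr_ge0 => n _; exact: sqr_ge0.
apply: ler_wsqrtr; rewrite mulr_suml; apply: ler_sum => n _.
rewrite -exprMn lerXn2r ?nnegrE ?normc_ge0 ?mulr_ge0 ?l2norm_ge0//.
rewrite mxE; apply: le_trans (normc_sum _ _) _; rewrite mulr_suml.
apply: ler_sum => m _; rewrite ComplexField.Normc.normcM normc_real.
by rewrite ler_wpM2l// normc_le_l2norm.
Qed.

(** The kernel is real, so the operator maps the complexification of a real
    vector to the complexification of its image: the complex operator norm also
    bounds the action on real vectors. *)
Lemma jacobi_op_real_sqnorm (a b : nat -> R) (L : nat) (E : R) (x : nat -> R) :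
  \sum_(n < L) (\sum_(m < n.+1) jacobi_kernel a b n.+1 m.+1 E * x m.+1) ^+ 2
  <= opnorm (@jacobi_op R a b L E) ^+ 2 * \sum_(n < L) x n.+1 ^+ 2.
Proof.
pose col (y : nat -> R) : 'cV[C]_L := \col_(k < L) real_complex R (y k.+1).
have l2col y : l2norm (col y) ^+ 2 = \sum_(n < L) y n.+1 ^+ 2.
  rewrite sqr_sqrtr; last by apply: sumr_ge0 => n _; exact: sqr_ge0.
  by apply: eq_bigr => n _; rewrite mxE normc_real real_normK ?num_real.
pose y n := \sum_(m < n) jacobi_kernel a b n m.+1 E * x m.+1.
have opcol : jacobi_op a b E (col x) = col y.
  apply/matrixP => n j; rewrite !mxE rmorph_sum.
  rewrite (big_ord_widen L (fun m => real_complex R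
    (jacobi_kernel a b n.+1 m.+1 E * x m.+1)) (ltn_ord n)).
  by apply: eq_bigr => m _; rewrite mxE rmorphM.
have [M hM] := jacobi_op_bounded a b L E.
have := l2norm_opnorm (@jacobi_opZ a b L E) hM (col x).
rewrite opcol -(l2col y) -(l2col x) -exprMn => le_op.
by rewrite lerXn2r ?nnegrE ?l2norm_ge0// (le_trans (l2norm_ge0 (col y)) le_op).
Qed.

End Norms.

(** Convexity of the square with weights |s| and |t|, in the division-free form
    that also covers s = t = 0. *)
Lemma sqr_comb_le (R : realDomainType) (s t x y : R) :
  (s * x - t * y) ^+ 2 <= (`|s| + `|t|) * (`|s| * x ^+ 2 + `|t| * y ^+ 2).
Proof.
have st : `|s * x - t * y| <= `|s| * `|x| + `|t| * `|y|.
  by rewrite -!normrM ler_normB.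
rewrite -[leLHS]real_normK ?num_real// -[x ^+ 2]real_normK ?num_real//.
rewrite -[y ^+ 2]real_normK ?num_real//.
apply: (@le_trans _ _ ((`|s| * `|x| + `|t| * `|y|) ^+ 2)).
  by rewrite lerXn2r ?nnegrE ?addr_ge0 ?mulr_ge0.
rewrite -subr_ge0.
have -> (p q X Y : R) : (p + q) * (p * X ^+ 2 + q * Y ^+ 2) -
  (p * X + q * Y) ^+ 2 = p * q * (X - Y) ^+ 2 by ring.
by rewrite mulr_ge0 ?sqr_ge0 ?mulr_ge0.
Qed.

Lemma opnorm_ge0 (R : realType) (L : nat) (T : 'cV[R[i]]_L -> 'cV[R[i]]_L) :
  0 <= opnorm T.
Proof.
rewrite /opnorm; set A := (X in sup X).
have [supA|/sup_out -> //] := pselect (has_sup A).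
have [[x Ax] ubA] := supA; apply: (@le_trans _ _ x); last exact: ub_le_sup.
by case: Ax => v _ <-; exact: l2norm_ge0.
Qed.

Lemma jacobi_zeros_spacing (R : realType) (a b : nat -> R) (L : nat)
  (E0 E' E'' : R) : jacobi_parameters a b ->
  root (jacobi_poly a b L) E' -> root (jacobi_poly a b L) E'' -> E' <> E'' ->
  (opnorm (@jacobi_op R a b L E0))^-1 <= `|E' - E0| + `|E'' - E0|.
Proof.
move=> hab z' z'' neq; have ortho := jacobi_orthogonal hab z' z'' neq.
have L_gt0 : (0 < L)%N by case: L z' {z'' ortho} => //; rewrite rootE hornerC oner_eq0.
set f := jacobi_sol a b E' 0 in ortho; set g := jacobi_sol a b E'' 0 in ortho.
pose sq (x : nat -> R) := \sum_(n < L) x n.+1 ^+ 2.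
have sq_ge0 x : 0 <= sq x by apply: sumr_ge0 => n _; exact: sqr_ge0.
pose D := sq f + sq g.
have D_gt0 : 0 < D.
  apply: ltr_wpDr => //; rewrite /sq (bigD1 (Ordinal L_gt0))//= -[f 1%N]/(cos 0).
  rewrite cos0 expr1n.
  by apply: ltr_wpDr => //; apply: sumr_ge0 => n _; exact: sqr_ge0.
set N := opnorm _; set S := _ + _.
have N_ge0 : 0 <= N by exact: opnorm_ge0.
have S_ge0 : 0 <= S by rewrite addr_ge0.
pose op (x : nat -> R) n := \sum_(m < n) jacobi_kernel a b n m.+1 E0 * x m.+1.
have ople x : sq (op x) <= N ^+ 2 * sq x by exact: jacobi_op_real_sqnorm.
have diffE n : f n - g n = (E' - E0) * op f n - (E'' - E0) * op g n.
  by rewrite -!jacobi_variation// -/f -/g; ring.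
(* Pythagoras: the cross term is twice the inner product of f and g. *)
have DE : D = \sum_(n < L) (f n.+1 - g n.+1) ^+ 2.
  rewrite /D /sq; under [RHS]eq_bigr do rewrite sqrrB.
  by rewrite big_split sumrB /= sumrMnl ortho mul0rn subr0.
have D_le : D <= (S * N) ^+ 2 * D.
  (* Convexity is applied coordinate by coordinate and then summed. *)
  have le1 : D <= S * (`|E' - E0| * sq (op f) + `|E'' - E0| * sq (op g)).
    rewrite DE /sq !mulr_sumr -big_split mulr_sumr /=.
    by apply: ler_sum => n _; rewrite diffE sqr_comb_le.
  apply: le_trans le1 _.
  have -> : (S * N) ^+ 2 * D = S * (S * (N ^+ 2 * D)) by ring.
  rewrite ler_wpM2l// mulrDl.
  have opleD x : sq x <= D -> sq (op x) <= N ^+ 2 * D.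
    by move=> xD; apply: le_trans (ople x) _; rewrite ler_wpM2l ?sqr_ge0.
  by apply: lerD; apply: ler_wpM2l => //; apply: opleD; rewrite ?lerDl ?lerDr.
(* As 1 <= S * N, the operator norm is nonzero and can be divided by. *)
have : 1 <= (S * N) ^+ 2 by rewrite -(ler_pM2r D_gt0) mul1r.
rewrite -{1}(expr1n R 2) ler_pXn2r ?nnegrE ?mulr_ge0// => SN.
have N_gt0 : 0 < N.
  rewrite lt_neqAle N_ge0 andbT; apply: contraTneq SN => <-.
  by rewrite mulr0 -ltNge.
by rewrite -(ler_pM2r N_gt0) mulVf ?gt_eqF.
Qed.

Theorem theorem2p2 (R : realType) (a b : nat -> R) (L : nat) (E0 : R)
  (hab : jacobi_parameters a b) :
  (forall E' E'' : R,
     root (jacobi_poly a b L) E' -> root (jacobi_poly a b L) E'' -> E' <> E'' ->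
     `|E' - E0| + `|E'' - E0| >= (opnorm (@jacobi_op R a b L E0))^-1)
  /\
  (forall zm zp : R,
     is_zero_below (jacobi_poly a b L) E0 zm ->
     is_zero_above (jacobi_poly a b L) E0 zp ->
     `|zp - zm| >= (opnorm (@jacobi_op R a b L E0))^-1).
Proof.
split=> [E' E''|zm zp [zm0 zmE _] [zp0 Ezp _]].
  exact: jacobi_zeros_spacing.
have zm_lt_zp := le_lt_trans zmE Ezp.
have -> : `|zp - zm| = `|zp - E0| + `|zm - E0|.
  rewrite (distrC zm E0) !ger0_norm ?subr_ge0 ?(ltW Ezp) ?(ltW zm_lt_zp)//.
  by ring.
by apply: jacobi_zeros_spacing => // zpm; rewrite zpm ltxx in zm_lt_zp.
Qed.
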